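(* The poset $(\mathcal{N},\le)$ of non-empty finite subsets of $\mathbb{N}$, with join $\vee$ and meet $\wedge$ given for $S,T\in\mathcal{N}$ by $$S\vee T=\bigl(S+\max(S\cup T)-\max S\bigr)\cup\bigl(T+\max(S\cup T)-\max T\bigr),$$ $$S\wedge T=\bigl(S-\max(S\cup T)+\max T\bigr)\cap\bigl(T-\max(S\cup T)+\max S\bigr),$$ is a distributive lattice.
   Context: Here $0\in\mathbb{N}$. For a set $S$ of integers and an integer $a$, $S\pm a=\{s\pm a\mid s\in S\}$. $\mathcal{N}$ is the set of finite non-empty subsets of $\mathbb{N}$. The partial order $\le$ on $\mathcal{N}$ is the one generated (as reflexive and transitive closure) by declaring $T<S$ whenever either (i) $T\subset S$ and $\max T=\max S$, or (ii) $S=T+1$. (Equivalently, in the source of this order: $T\le S$ when there is a composite of left adjoints of identity-identity and shift-décalage Quillen adjunctions from the $T$-indexed model structure on filtered chain complexes to the $S$-indexed one.) A lattice is a poset with binary operations $\vee$ (join) and $\wedge$ (meet) giving least upper bounds and greatest lower bounds; it is distributive if $a\vee(b\wedge c)=(a\vee b)\wedge(a\vee c)$ and $a\wedge(b\vee c)=(a\wedge b)\vee(a\wedge c)$ for all $a,b,c$. *)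

(* Defs.v *)
From mathcomp Require Import all_boot all_order all_algebra finmap.
From Stdlib Require Export Relation_Operators.
Set Implicit Arguments.
Unset Strict Implicit.
Unset Printing Implicit Defensive.
Import GRing.Theory.
Local Open Scope fset_scope.
Local Open Scope ring_scope.

Definition finsubset : Type := {S : {fset nat} | S != fset0}.

Definition natset (S : finsubset) : {fset nat} := sval S.

(* Translates are formed in the integers: the translates in the formula for the
   meet may contain negative integers. *)
Definition intset (S : finsubset) : {fset int} := [fset (n%:Z) | n in natset S].

Definition translate (A : {fset int}) (a : int) : {fset int} :=
  [fset (s + a) | s in A].

(* The empty set, on which this is 0, never occurs. *)
Definition maxelt (A : {fset nat}) : nat := \max_(i <- A) i.

Definition gen_lt (T S : finsubset) : Prop :=
  (natset T `<` natset S /\ maxelt (natset T) = maxelt (natset S))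
  \/ intset S = translate (intset T) 1.

Definition gen_le : finsubset -> finsubset -> Prop :=
  clos_refl_trans finsubset gen_lt.

(* Main.v *)
Require Import Defs.
From mathcomp Require Import all_boot all_order all_algebra finmap.
From mathcomp Require Import zify.
From HB Require Import structures.
Set Implicit Arguments.
Unset Strict Implicit.
Unset Printing Implicit Defensive.
Import Order.TTheory GRing.Theory.
Local Open Scope ring_scope.

(** Measure the elements of S downwards from the top: write m = max S and
    D = m - S, the finite set of depths below m at which S has an element.
    Then S is determined by the pair (m, D), and the pairs that occur are those
    with 0 in D and D contained in [0, m] ([topK], [depthsK], [depthsP]).
    In these coordinates a generator of type (i) keeps m and enlarges D, while a
    generator of type (ii) keeps D and replaces m by m + 1.  Hence the generated
    order is the product order, m growing and D growing ([gen_leP]): going up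
    from (m, D) to (m', D'), first raise m one unit at a time, which preserves
    the bound on D, and then enlarge D at the fixed height m'.

    The pairs that occur are closed under (max, union) and (min, intersection),
    so they form a sublattice of the distributive lattice N x P(N), and every
    lattice identity is inherited coordinatewise.  Finally a translate of S is
    the set of the numbers p - k for k in D, where p is the translate of m
    ([translate_below]).  The two translates in each formula of the statement
    are arranged to have the same top p, and for fixed p the map D |-> p - D
    commutes with unions and intersections. *)

(** * Coordinates: the maximum and the set of depths below it *)

Lemma maxelt_leqP (A : {fset nat}) (m : nat) :
  reflect (forall n, n \in A -> (n <= m)%N) (maxelt A <= m)%N.
Proof.
apply: (iffP (bigmax_leqP_seq _ _ _ _)) => h n nA; first exact: h.
by move=> _; apply: h.
Qed.

Lemma leq_maxelt (A : {fset nat}) (n : nat) : n \in A -> (n <= maxelt A)%N.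
Proof. by move=> nA; apply: (maxelt_leqP A _ (leqnn _)). Qed.

Lemma maxelt_in (A : {fset nat}) : A != fset0 -> maxelt A \in A.
Proof.
case/fset0Pn => x; rewrite /maxelt.
change (x \in enum_fset A -> \max_(i <- enum_fset A) i \in enum_fset A).
elim: (enum_fset A) x => [//|a s IH] _ _.
rewrite big_cons inE; case: s IH => [|b s] IH; first by rewrite big_nil maxn0 eqxx.
by rewrite maxnC /maxn; case: ifP => _; rewrite ?eqxx // (IH b) ?orbT ?mem_head.
Qed.

Lemma maxeltU (A B : {fset nat}) :
  maxelt (A `|` B)%fset = maxn (maxelt A) (maxelt B).
Proof.
apply/eqP; rewrite eqn_leq geq_max; apply/andP; split.
  apply/maxelt_leqP => n; rewrite inE leq_max.
  by case/orP => /leq_maxelt ->; rewrite ?orbT.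
by apply/andP; split; apply/maxelt_leqP => n nA; apply: leq_maxelt;
   rewrite inE nA ?orbT.
Qed.

Definition top (S : finsubset) : nat := maxelt (natset S).

Definition depths (S : finsubset) : {fset nat} :=
  [fset (top S - n)%N | n in natset S]%fset.

Lemma top_in (S : finsubset) : top S \in natset S.
Proof. exact: maxelt_in (valP S). Qed.

Lemma mem_depths (S : finsubset) (k : nat) :
  (k \in depths S) = (k <= top S)%N && ((top S - k)%N \in natset S).
Proof.
apply/imfsetP/andP => [[n /= nS ->]|[le_k kS]].
  by rewrite leq_subr subKn // leq_maxelt.
by exists (top S - k)%N; rewrite //= subKn.
Qed.

Lemma mem_natset (S : finsubset) (n : nat) :
  (n \in natset S) = (n <= top S)%N && ((top S - n)%N \in depths S).
Proof.
rewrite mem_depths leq_subr /=; apply/idP/andP => [nS|[le_n]].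
  by rewrite leq_maxelt // subKn // leq_maxelt.
by rewrite subKn.
Qed.

Definition bounded_depths (m : nat) (D : {fset nat}) : Prop :=
  0%N \in D /\ forall k, k \in D -> (k <= m)%N.

Lemma depthsP (S : finsubset) : bounded_depths (top S) (depths S).
Proof.
split=> [|k]; first by rewrite mem_depths subn0 top_in.
by rewrite mem_depths => /andP[].
Qed.

Lemma coord_inj (S T : finsubset) :
  top S = top T -> depths S = depths T -> S = T.
Proof.
move=> eq_top eq_depths; apply/val_inj/fsetP => n.
by rewrite -!/(natset _) !mem_natset eq_top eq_depths.
Qed.

Lemma of_depths_neq0 (m : nat) (D : {fset nat}) :
  (m |` [fset (m - k)%N | k in D])%fset != fset0.
Proof. by apply/fset0Pn; exists m; rewrite !inE eqxx. Qed.

(** Adjoining m makes the set non-empty whatever D is, so that the construction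
    is total; it changes nothing when 0 is in D. *)
Definition of_depths (m : nat) (D : {fset nat}) : finsubset :=
  exist _ (m |` [fset (m - k)%N | k in D])%fset (of_depths_neq0 m D).

Lemma topK (m : nat) (D : {fset nat}) : top (of_depths m D) = m.
Proof.
apply/eqP; rewrite eqn_leq; apply/andP; split.
  apply/maxelt_leqP => n; rewrite !inE => /orP[/eqP->//|/imfsetP[k _ ->]].
  exact: leq_subr.
by apply: leq_maxelt; rewrite !inE eqxx.
Qed.

Lemma depthsK (m : nat) (D : {fset nat}) :
  bounded_depths m D -> depths (of_depths m D) = D.
Proof.
case=> D0 leD; apply/fsetP => k; rewrite mem_depths topK !inE.
apply/andP/idP => [[le_k /orP[/eqP eq_m|/imfsetP[j /= jD eq_j]]]|kD].
- by have -> : k = 0%N by lia.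
- by have le_j := leD j jD; have -> : k = j by lia.
- by rewrite leD //; split=> //; apply/orP; right; apply: in_imfset.
Qed.

Lemma of_depthsK (S : finsubset) : of_depths (top S) (depths S) = S.
Proof. by apply: coord_inj; rewrite ?topK ?depthsK //; apply: depthsP. Qed.

(** * Translates *)

Definition below (p : int) (D : {fset nat}) : {fset int} :=
  [fset (p - k%:Z) | k in D]%fset.

Lemma mem_below (p x : int) (D : {fset nat}) :
  (x \in below p D) = (x <= p) && (absz (p - x)%R \in D).
Proof.
apply/imfsetP/andP => [[k /= kD ->]|[le_x xD]].
  by split; [lia | have -> : absz (p - (p - k%:Z))%R = k by lia].
by exists (absz (p - x)%R) => //=; lia.
Qed.

Lemma belowU (p : int) (D E : {fset nat}) :
  below p (D `|` E)%fset = (below p D `|` below p E)%fset.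
Proof. by apply/fsetP => x; rewrite !inE !mem_below inE andb_orr. Qed.

Lemma belowI (p : int) (D E : {fset nat}) :
  below p (D `&` E)%fset = (below p D `&` below p E)%fset.
Proof. by apply/fsetP => x; rewrite !inE !mem_below inE andbACA andbb. Qed.

(** The condition that 0 is a depth makes p the greatest element of
    [below p D], so that p, and then D, can be read off. *)
Lemma below_inj (p q : int) (D E : {fset nat}) :
  0%N \in D -> 0%N \in E -> below p D = below q E -> p = q /\ D = E.
Proof.
move=> D0 E0 eqDE.
have eqpq : p = q.
  have: p \in below q E by rewrite -eqDE mem_below subrr lexx.
  have: q \in below p D by rewrite eqDE mem_below subrr lexx.
  by rewrite !mem_below => /andP[le_qp _] /andP[le_pq _]; lia.
split=> //; apply/fsetP => k.
have := congr1 (fun A : {fset int} => p - k%:Z \in A) eqDE.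
rewrite -eqpq !mem_below; have -> : absz (p - (p - k%:Z))%R = k by lia.
by have -> : p - k%:Z <= p by lia.
Qed.

Lemma intset_below (S : finsubset) : intset S = below (top S)%:Z (depths S).
Proof.
apply/fsetP => x; rewrite mem_below mem_depths.
apply/imfsetP/idP => [[n /= nS ->]|/and3P[le_x le_top xS]].
  have le_n := leq_maxelt nS; rewrite -/(top S) in le_n.
  have -> : absz ((top S)%:Z - n%:Z)%R = (top S - n)%N by lia.
  by rewrite subKn // nS leq_subr; lia.
by exists (top S - absz ((top S)%:Z - x)%R)%N => //; lia.
Qed.

Lemma translate_below (S : finsubset) (a : int) :
  translate (intset S) a = below ((top S)%:Z + a) (depths S).
Proof.
rewrite intset_below; apply/fsetP => x; rewrite mem_below.
apply/imfsetP/idP => [[y /=]|xS].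
  rewrite mem_below => /andP[le_y yS] ->.
  have -> : (top S)%:Z + a - (y + a) = (top S)%:Z - y by lia.
  by rewrite yS andbT; lia.
exists (x - a) => /=; last by lia.
rewrite mem_below; have -> : (top S)%:Z - (x - a) = (top S)%:Z + a - x by lia.
by case/andP: xS => le_x ->; rewrite andbT; lia.
Qed.

(** * The generated order is the product order *)

Definition coord_le (S T : finsubset) : bool :=
  (top S <= top T)%N && (depths S `<=` depths T)%fset.

Lemma coord_le_refl : reflexive coord_le.
Proof. by move=> S; rewrite /coord_le leqnn fsubset_refl. Qed.

Lemma coord_le_trans : transitive coord_le.
Proof.
move=> T S U /andP[topST depthsST] /andP[topTU depthsTU].
by rewrite /coord_le (leq_trans topST) // (fsubset_trans depthsST).
Qed.

Lemma gen_lt_coord_le (T S : finsubset) : gen_lt T S -> coord_le T S.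
Proof.
case=> [[/fproper_sub/fsubsetP subTS eq_top]|].
  rewrite /coord_le /top eq_top leqnn /=.
  apply/fsubsetP => k; rewrite !mem_depths /top eq_top.
  by case/andP => -> /subTS.
rewrite intset_below translate_below => eqTS.
have [eq_top eq_depths] :=
  below_inj (proj1 (depthsP S)) (proj1 (depthsP T)) eqTS.
by rewrite /coord_le eq_depths fsubset_refl andbT; lia.
Qed.

(** Each unit step is a generator of type (ii); it stays inside the natural
    numbers because raising the top only relaxes the bound on the depths. *)
Lemma gen_le_raise (T : finsubset) (j : nat) :
  gen_le T (of_depths (top T + j) (depths T)).
Proof.
have bd i : bounded_depths (top T + i) (depths T).
  have [T0 leT] := depthsP T; split=> // k /leT le_k.
  exact: leq_trans le_k (leq_addr _ _).
elim: j => [|j IH]; first by rewrite addn0 of_depthsK; apply: rt_refl.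
apply: rt_trans IH _; apply: rt_step; right.
rewrite translate_below intset_below !topK !depthsK //.
by congr below; lia.
Qed.

(** Every generator moves up in the product order, which is reflexive and
    transitive; conversely T can be raised to the height of S by steps of type
    (ii), after which at most one step of type (i) is left. *)
Lemma gen_leP (T S : finsubset) : gen_le T S <-> coord_le T S.
Proof.
split.
  elim=> [? ? /gen_lt_coord_le //|?|? U ? _ TU _ US]; first exact: coord_le_refl.
  exact: coord_le_trans TU US.
case/andP=> le_top /fsubsetP sub_depths.
set U := of_depths (top S) (depths T).
have TU : gen_le T U by have := gen_le_raise T (top S - top T); rewrite subnKC.
have topU : top U = top S by apply: topK.
have depthsU : depths U = depths T.
  apply: depthsK; split; first exact: (proj1 (depthsP T)).
  by move=> k /sub_depths; apply: (proj2 (depthsP S)).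
apply: rt_trans TU _; case: (eqVneq (natset U) (natset S)) => [eqUS|neqUS].
  by rewrite (val_inj eqUS : U = S); apply: rt_refl.
apply: rt_step; left; split=> //; rewrite fproperEneq neqUS.
apply/fsubsetP => n; rewrite !mem_natset topU depthsU.
by case/andP=> -> /sub_depths.
Qed.

(** * The lattice operations *)

Definition join (S T : finsubset) : finsubset :=
  of_depths (maxn (top S) (top T)) (depths S `|` depths T)%fset.

Definition meet (S T : finsubset) : finsubset :=
  of_depths (minn (top S) (top T)) (depths S `&` depths T)%fset.

Lemma top_join (S T : finsubset) : top (join S T) = maxn (top S) (top T).
Proof. exact: topK. Qed.

Lemma top_meet (S T : finsubset) : top (meet S T) = minn (top S) (top T).
Proof. exact: topK. Qed.

Lemma depths_join (S T : finsubset) :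
  depths (join S T) = (depths S `|` depths T)%fset.
Proof.
have [[S0 leS] [T0 leT]] := (depthsP S, depthsP T).
apply: depthsK; split=> [|k]; rewrite inE ?S0 // leq_max.
by case/orP=> [/leS|/leT] ->; rewrite ?orbT.
Qed.

Lemma depths_meet (S T : finsubset) :
  depths (meet S T) = (depths S `&` depths T)%fset.
Proof.
have [[S0 leS] [T0 leT]] := (depthsP S, depthsP T).
apply: depthsK; split=> [|k]; rewrite inE ?S0 // leq_min.
by case/andP=> /leS -> /leT.
Qed.

Definition coordE := (top_join, top_meet, depths_join, depths_meet).

Lemma coord_leE (S T : finsubset) : coord_le S T = (meet S T == S).
Proof.
apply/andP/eqP => [[le_top sub_depths]|eq_meet].
  apply: coord_inj; rewrite !coordE; first exact/minn_idPl.
  exact/fsetIidPl.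
split; first by apply/minn_idPl; rewrite -top_meet eq_meet.
by apply/fsetIidPl; rewrite -depths_meet eq_meet.
Qed.

Lemma meetC : commutative meet.
Proof. by move=> S T; rewrite /meet minnC fsetIC. Qed.

Lemma joinC : commutative join.
Proof. by move=> S T; rewrite /join maxnC fsetUC. Qed.

Lemma meetA : associative meet.
Proof.
by move=> S T U; apply: coord_inj; rewrite !coordE ?minnA ?fsetIA.
Qed.

Lemma joinA : associative join.
Proof.
by move=> S T U; apply: coord_inj; rewrite !coordE ?maxnA ?fsetUA.
Qed.

Lemma joinKI (T S : finsubset) : meet S (join S T) = S.
Proof.
apply: coord_inj; rewrite !coordE; first by lia.
by apply/fsetP => k; rewrite !inE; case: (k \in depths S). Qed.

Lemma meetKU (T S : finsubset) : join S (meet S T) = S.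
Proof.
apply: coord_inj; rewrite !coordE; first by lia.
by apply/fsetP => k; rewrite !inE; case: (k \in depths S). Qed.

Lemma meetUl : left_distributive meet join.
Proof.
by move=> S T U; apply: coord_inj; rewrite !coordE ?minn_maxl ?fsetIUl.
Qed.

Lemma meetxx : idempotent_op meet.
Proof. by move=> S; apply: coord_inj; rewrite !coordE ?minnn ?fsetIid. Qed.

(** A name for [finsubset] that carries the display, to which the instances for
    an arbitrary display can be attached. *)
Definition displayed (d : Order.disp_t) : Type := finsubset.

HB.instance Definition _ (d : Order.disp_t) :=
  [Choice of displayed d by <:].

HB.instance Definition _ (d : Order.disp_t) :=
  Order.isMeetJoinDistrLattice.Build d (displayed d)
    coord_leE (fun _ _ => erefl) meetC joinC meetA joinA joinKI meetKU
    meetUl meetxx.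

Theorem theorem4 (d : Order.disp_t) :
  exists c : Order.DistrLattice d finsubset,
    forall S T : Order.DistrLattice.Pack c,
      let maxS := (maxelt (natset S))%:Z in
      let maxT := (maxelt (natset T))%:Z in
      let maxST := (maxelt (natset S `|` natset T)%fset)%:Z in
      [/\ (T <= S)%O <-> gen_le T S,
          intset (S `|` T)%O =
            (translate (intset S) (maxST - maxS)
             `|` translate (intset T) (maxST - maxT))%fset
        & intset (S `&` T)%O =
            (translate (intset S) (- maxST + maxT)
             `&` translate (intset T) (- maxST + maxS))%fset].
Proof.
exists (Order.DistrLattice.class (displayed d : distrLatticeType d)).
move=> S T maxS maxT maxST.
have eq_maxST : maxST = (maxn (top S) (top T))%:Z by rewrite /maxST maxeltU.
split; first exact: iff_sym (gen_leP T S).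
- rewrite -[Order.join _ _]/(join S T) intset_below !translate_below.
  rewrite top_join depths_join belowU; congr (below _ _ `|` below _ _)%fset;
    rewrite eq_maxST /maxS /maxT -!/(top _); lia.
- rewrite -[Order.meet _ _]/(meet S T) intset_below !translate_below.
  rewrite top_meet depths_meet belowI; congr (below _ _ `&` below _ _)%fset;
    rewrite eq_maxST /maxS /maxT -!/(top _); lia.
Qed.
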